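(* Let $\lambda:\mathbb{Z}_+\to[0,\infty)$ with $\lambda(0)>0$ and $\mu_1,\mu_2>0$. Assume that $\lambda(n)=0$ eventually for large $n$ (i.e. there is $K$ with $\lambda(n)=0$ for all $n>K$). (i) If $\mu_1<\mu_2$, then $S(\lambda,\mu_1,\mu_2)$ is stable if and only if $\mathrm{E}\,\lambda(Z)<\mu_1$ with $Z\sim\operatorname{geom}(\mu_1/\mu_2)$. (ii) If $\mu_1\ge\mu_2$, then $S(\lambda,\mu_1,\mu_2)$ is always stable.
   Context: $\mathbb{Z}_+=\{0,1,2,\dots\}$ and $e_1,e_2$ are the unit vectors of $\mathbb{Z}_+^2$. The system $S(\lambda,\mu_1,\mu_2)$ (for a nonnegative function $\lambda$ on $\mathbb{Z}_+$ and $\mu_1,\mu_2>0$) is the set of transition rates $q(x,y)$, $x\ne y$, $x,y\in\mathbb{Z}_+^2$, given by $q(x,x+e_1)=\lambda(x_2)$; $q(x,x-e_1+e_2)=\mu_1$ if $x_1\ge1$; $q(x,x-e_2)=\mu_2$ if $x_2\ge 1$; and $q(x,y)=0$ otherwise. Set $q(x)=\sum_{y\ne x}q(x,y)<\infty$ and $q(x,x)=-q(x)$. These rates define, by the minimal construction, a unique continuous-time Markov process $X=(X_1,X_2)$ on $\mathbb{Z}_+^2\cup\{\kappa\}$, where $\kappa$ is an extra state entered at the explosion time. The system is called stable if this Markov process is ergodic, that is, irreducible and positive recurrent (on $\mathbb{Z}_+^2$). For $0\le z<1$, $Z\sim\operatorname{geom}(z)$ means that $Z$ takes values in $\mathbb{Z}_+$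 with $\mathrm{P}(Z=j)=(1-z)z^j$. *)

(* Defs.v *)
From HB Require Import structures.
From mathcomp Require Import all_boot all_order all_algebra.
From mathcomp Require Import all_classical all_reals all_analysis.
From mathcomp Require Import measurable_realfun random_variable.

Set Implicit Arguments.
Unset Strict Implicit.
Unset Printing Implicit Defensive.

Import Order.TTheory GRing.Theory Num.Theory.
Import numFieldNormedType.Exports.

Local Open Scope classical_set_scope.
Local Open Scope ring_scope.

Section MinimalProcess.
Context {R : realType} {T : countType}.
(* Only the off-diagonal values of [q] are used; the diagonal entry of the
   generator is [- exit_rate q x]. *)
Variable q : T -> T -> R.

(* [fine] is harmless only for rates with finite row sums. *)
Definition exit_rate (x : T) : R :=
  fine (\esum_(y in [set y | y != x]) (q x y)%:E).

Definition jump_prob (x y : T) : R :=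
  if exit_rate x == 0 then (x == y)%:R
  else if y == x then 0 else q x y / exit_rate x.

Definition jump_time {Omega : Type} (S : nat -> Omega -> \bar R)
    (n : nat) (w : Omega) : \bar R :=
  (\sum_(k < n) S k w)%E.

(* Joint law, under [P], of the jump chain [Y] and the holding times [S]
   started at [x]: [Y] is a Markov chain with matrix [jump_prob] and, given [Y],
   the [S i] are independent exponential variables of parameters
   [exit_rate (Y i)].  Parameter 0 gives [S i = +oo] almost surely. *)
Definition jump_hold_law d (Omega : measurableType d) (P : probability Omega R)
    (x : T) (Y : nat -> Omega -> T) (S : nat -> Omega -> \bar R) : Prop :=
  forall (n : nat) (y : nat -> T) (t : nat -> R), (forall i, 0 <= t i) ->
    P [set w | forall i, (i <= n)%N -> Y i w = y i /\ ((t i)%:E < S i w)%E] =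
    ((y 0%N == x)%:R * (\prod_(i < n) jump_prob (y i) (y i.+1))
      * (\prod_(i < n.+1) expR (- (exit_rate (y i) * t i))))%:E.

(* [X] is the minimal Markov process with rates [q] started at [x]; [None] is
   the extra state entered at the explosion time [sup_n jump_time S n].  Only
   the times [0 <= t] are relevant. *)
Definition minimal_process d (Omega : measurableType d)
    (P : probability Omega R) (x : T) (X : R -> Omega -> option T) : Prop :=
  exists (Y : nat -> Omega -> T) (S : nat -> Omega -> \bar R),
    [/\ forall n y, measurable [set w | Y n w = y],
        forall n, measurable_fun [set: Omega] (S n),
        forall n w, (0 <= S n w)%E,
        jump_hold_law P x Y S
      & forall (t : R) (w : Omega), 0 <= t ->
          (forall n, (jump_time S n w <= t%:E)%E ->
             (t%:E < jump_time S n.+1 w)%E -> X t w = Some (Y n w)) /\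
          ((forall n, (jump_time S n w <= t%:E)%E) -> X t w = None)].

End MinimalProcess.

Section Ergodicity.
Context {R : realType} {T : countType} {d : measure_display}
        {Omega : measurableType d}.
Variables (P : T -> probability Omega R) (X : R -> Omega -> option T).

(* First time at [x] after having been out of [x]; [+oo] if there is none. *)
Definition return_time (x : T) (w : Omega) : \bar R :=
  ereal_inf [set t%:E | t in [set t : R |
    [/\ 0 <= t, X t w = Some x
      & exists s : R, [/\ 0 <= s, s < t & X s w <> Some x]]]].

Definition irreducible : Prop :=
  forall x y : T, exists2 t : R, 0 <= t & (0 < P x [set w | X t w = Some y])%E.

(* Absorbing states do not qualify; this matters only for one-point spaces
   when combined with irreducibility. *)
Definition positive_recurrent : Prop :=
  forall x : T, (\int[P x]_w return_time x w < +oo)%E.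

Definition ergodic : Prop := irreducible /\ positive_recurrent.

End Ergodicity.

Definition system_rate {R : realType} (lambda : nat -> R) (mu1 mu2 : R)
    (x y : nat * nat) : R :=
  if y == (x.1.+1, x.2) then lambda x.2
  else if (1 <= x.1)%N && (y == (x.1.-1, x.2.+1)) then mu1
  else if (1 <= x.2)%N && (y == (x.1, x.2.-1)) then mu2
  else 0.

Definition geometric_law {R : realType} d (Omega : measurableType d)
    (P : probability Omega R) (Z : Omega -> nat) (z : R) : Prop :=
  forall j : nat, P [set w | Z w = j] = ((1 - z) * z ^+ j)%:E.

(* Main.v *)
Require Import Defs.
From mathcomp Require Import all_boot all_order all_algebra.
From mathcomp Require Import all_classical all_reals all_analysis.
From mathcomp Require Import measurable_realfun random_variable.
From mathcomp Require Import ring lra zify.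
Import Order.TTheory GRing.Theory Num.Theory.
Import numFieldNormedType.Exports.
Local Open Scope classical_set_scope.
Local Open Scope ring_scope.

(** Write rho for mu1 / mu2. While the first queue is
  nonempty the second one is an M/M/1 queue with arrival rate mu1 and service
  rate mu2, whatever the first queue does, and the first queue drifts at speed
  lambda(x2) - mu1. If mu1 < mu2 the second queue then settles to the geometric
  law of parameter rho, so the averaged drift of the first queue is
  E lambda(Z) - mu1, and its sign decides. If mu1 >= mu2 the second queue does
  not settle, lambda vanishes most of the time, and the averaged drift is -mu1.

  Since the exit rates lie between two positive constants, the process does not
  explode and the mean return time to x is finite exactly when the mean return
  step of the jump chain is, that is, when sum_k survival x k x is finite, where
  survival x k y is the probability that the chain started at y does not visit x
  at the steps 1, ..., k. The two halves of this equivalence are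
  [summable_survival_of_integrable] and [integrable_of_summable_survival];
  irreducibility comes from explicit paths in both regimes
  ([tandem_leads_to], [accessible_of_leads_to]).

  What remains concerns the jump chain, and is settled by one family of test
  functions f(x) = x1 + h(x2). Choosing the increments g(n) = h(n+1) - h(n) by
  mu1 g(n) = mu2 g(n-1) + theta - lambda(n) solves the Poisson equation of the
  M/M/1 queue up to a constant: the generator applied to f is exactly
  theta - mu1 wherever x1 >= 1. On the edge x1 = 0, beyond the support of lambda,
  it is -mu2 g(x2-1), so everything hinges on the sign of g at infinity, which
  the formula mu1 rho^n g(n) = sum_(k <= n) rho^k (theta - lambda(k)) gives.

  - If mu1 < mu2 and E lambda(Z) < theta < mu1, then g is eventually bounded
    below by a positive constant; if mu1 >= mu2 this holds for every theta > 0.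
    Hence f is bounded below and has a uniformly negative drift off a finite
    set, and Foster's argument ([foster_criterion]) gives positive recurrence.
  - If mu1 < mu2 and theta = E lambda(Z) >= mu1, then g is bounded and
    eventually negative, so f has bounded increments and nonnegative drift off
    a finite set. With C an upper bound of f on that set, max(f - C, 0) is an
    unbounded nonnegative submartingale with bounded increments which vanishes
    at the origin; this forces survival probabilities of order 1/n
    ([submartingale_survival]), which are not summable. *)

(** * Locally finite Markov kernels *)

(** [nb y] lists the possible successors of [y], so that every expectation after
  one step is a finite sum. It may contain states of probability zero, but not
  [y] itself. *)
Record locally_finite_kernel {R : realType} {T : eqType} (p : T -> T -> R)
    (nb : T -> seq T) : Prop := LocallyFiniteKernel {
  kernel_ge0 : forall y z, 0 <= p y z;
  nb_uniq : forall y, uniq (nb y);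
  nb_irreflexive : forall y, y \notin nb y;
  kernel_sum1 : forall y, \sum_(z <- nb y) p y z = 1 }.

Arguments kernel_ge0 {R T p nb}.
Arguments nb_uniq {R T p nb}.
Arguments nb_irreflexive {R T p nb}.
Arguments kernel_sum1 {R T p nb}.

Section KernelDefinitions.
Context {R : realType} {T : eqType}.
Variables (p : T -> T -> R) (nb : T -> seq T).

(** The kernel killed on entering the complement of [A]. *)
Definition step (A : pred T) (f : T -> R) (y : T) : R :=
  \sum_(z <- nb y | A z) p y z * f z.

(** The probability, starting from [y], of not being at [x] at the steps
  1, ..., k. The starting point is not tested, so [survival x k x] is the tail of
  the return step to [x]. *)
Definition survival (x : T) (k : nat) : T -> R :=
  iter k (step (predC1 x)) (fun=> 1).

(** The [m]-th iterate is the probability of being at [x] after [m] steps. *)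
Definition leads_to (y x : T) : Prop :=
  exists m, 0 < iter m (step predT) (fun z => (z == x)%:R) y.

End KernelDefinitions.

Section KernelTheory.
Context {R : realType} {T : eqType} {p : T -> T -> R} {nb : T -> seq T}.
Hypothesis pK : locally_finite_kernel p nb.

Local Notation step := (step p nb).
Local Notation survival := (survival p nb).
Local Notation leads_to := (leads_to p nb).

Lemma ler_step (A : pred T) (f g : T -> R) y :
  (forall z, z \in nb y -> A z -> f z <= g z) -> step A f y <= step A g y.
Proof.
move=> fg; rewrite /step big_seq_cond [leRHS]big_seq_cond.
by apply: ler_sum => z /andP[zy Az]; rewrite ler_wpM2l ?(kernel_ge0 pK) ?fg.
Qed.

Lemma step_ge0 (A : pred T) (f : T -> R) y :
  (forall z, 0 <= f z) -> 0 <= step A f y.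
Proof. by move=> f0; apply: sumr_ge0 => z _; rewrite mulr_ge0 ?(kernel_ge0 pK). Qed.

Lemma step_le_full (A : pred T) (f : T -> R) y : (forall z, 0 <= f z) ->
  step A f y <= step predT f y.
Proof.
move=> f0; rewrite /step [leRHS](bigID A)/= lerDl.
by apply: sumr_ge0 => z _; rewrite mulr_ge0 ?(kernel_ge0 pK).
Qed.

Lemma step_cst (c : R) y : step predT (fun=> c) y = c.
Proof. by rewrite /step -big_distrl/= (kernel_sum1 pK) mul1r. Qed.

Lemma stepD (A : pred T) (f g : T -> R) y :
  step A (fun z => f z + g z) y = step A f y + step A g y.
Proof. by rewrite /step -big_split/=; apply: eq_bigr => z _; rewrite mulrDr. Qed.

Lemma stepZ (A : pred T) (c : R) (f : T -> R) y :
  step A (fun z => c * f z) y = c * step A f y.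
Proof. by rewrite /step big_distrr/=; apply: eq_bigr => z _; rewrite mulrCA. Qed.

Lemma survivalS x k y :
  survival x k.+1 y = step (predC1 x) (survival x k) y.
Proof. by []. Qed.

Lemma survival_ge0 x k y : 0 <= survival x k y.
Proof. by elim: k y => [|k IH] y //=; apply: step_ge0. Qed.

Lemma survival_nonincreasing x k y : survival x k.+1 y <= survival x k y.
Proof.
elim: k y => [|k IH] y; last by apply: ler_step => z _ _; exact: IH.
by rewrite survivalS (le_trans (step_le_full _ _ _ _))// step_cst.
Qed.

Lemma survival_le x m n y : (m <= n)%N -> survival x n y <= survival x m y.
Proof.
move=> /subnK <-; elim: (n - m)%N => [|k IH] //.
by rewrite addSn (le_trans (survival_nonincreasing _ _ _)).
Qed.

Lemma survival_le1 x k y : survival x k y <= 1.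
Proof. exact: (survival_le x 0). Qed.

(** Being at [x] at step m + 1 and avoiding [x] up to step m + 1 exclude each
  other. This turns accessibility into survival probabilities below 1. *)
Lemma survival_add_visit x m y :
  survival x m.+1 y + iter m.+1 (step predT) (fun z => (z == x)%:R) y <= 1.
Proof.
elim: m y => [|m IH] y.
  rewrite -[leRHS](kernel_sum1 pK y) /= /step big_mkcond/= -big_split/=.
  apply: ler_sum => z _; rewrite mulr1.
  by case: eqVneq => _ /=; rewrite ?mulr1 ?mulr0 ?add0r ?addr0.
rewrite -[leRHS](kernel_sum1 pK y) survivalS iterS.
rewrite {1}/step big_mkcond {2}/step -big_split.
apply: ler_sum => z _; have pz := kernel_ge0 pK y z.
have := IH z; set v := iter _ _ _ _ => Hz.
have sz := survival_ge0 x m.+1 z.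
rewrite [X in if X then _ else _](_ : _ = (z != x))//.
case: eqVneq => [zx|_] /=; rewrite ?add0r -?mulrDr ler_piMr//.
by rewrite (le_trans _ Hz)// lerDr.
Qed.

Lemma iter_step_survival_le x (f : T -> R) (c : R) k y : (forall z, f z <= c) ->
  iter k (step (predC1 x)) f y <= c * survival x k y.
Proof.
move=> fc; elim: k y => [|k IH] y; first by rewrite /survival/= mulr1.
by rewrite survivalS -stepZ iterS; apply: ler_step => z _ _; exact: IH.
Qed.

Lemma iter_step_survival_ge x (f : T -> R) (c : R) k y : (forall z, c <= f z) ->
  c * survival x k y <= iter k (step (predC1 x)) f y.
Proof.
move=> fc; elim: k y => [|k IH] y; first by rewrite /survival/= mulr1.
by rewrite survivalS -stepZ iterS; apply: ler_step => z _ _; exact: IH.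
Qed.

Lemma iter_step_cst (c : R) k y : iter k (step predT) (fun=> c) y = c.
Proof.
elim: k y => [|k IH] y //=; rewrite -[RHS](step_cst c y).
by rewrite /step; apply: eq_bigr => z _; rewrite IH.
Qed.

Lemma leads_to_refl x : leads_to x x.
Proof. by exists 0%N; rewrite /= eqxx ltr01. Qed.

Lemma visit_step_gt0 x y z m : z \in nb y -> 0 < p y z ->
  0 < iter m (step predT) (fun z => (z == x)%:R) z ->
  0 < iter m.+1 (step predT) (fun z => (z == x)%:R) y.
Proof.
move=> zy pz vz; rewrite /= /step (perm_big _ (perm_to_rem zy)) big_cons/=.
rewrite ltr_pwDl ?mulr_gt0//; apply: sumr_ge0 => u _.
rewrite mulr_ge0 ?(kernel_ge0 pK)//.
by elim: m u {vz} => [|m IH] u /=; [rewrite ler0n|exact: step_ge0].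
Qed.

Lemma leads_to_step y z x : z \in nb y -> 0 < p y z -> leads_to z x ->
  leads_to y x.
Proof. by move=> zy pz [m mz]; exists m.+1; exact: visit_step_gt0 mz. Qed.

Lemma survival_lt1 x y z : z \in nb y -> 0 < p y z -> leads_to z x ->
  exists m, survival x m y < 1.
Proof.
move=> zy pz [m mz]; exists m.+1.
have := survival_add_visit x m y; have := visit_step_gt0 _ _ _ _ zy pz mz; lra.
Qed.

(** The partial sum is the mean of the hitting step truncated at n + 1; the
  equation is its decomposition at the first step. *)
Lemma survival_sumS x n y : \sum_(k < n.+1) survival x k y =
  1 + step (predC1 x) (fun z => \sum_(k < n) survival x k z) y.
Proof.
rewrite big_ord_recl; congr (_ + _); rewrite /step.
under [RHS]eq_bigr do rewrite big_distrr/=.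
by rewrite exchange_big.
Qed.

Lemma survival_uniform x (F : seq T) :
  (forall y, y \in F -> exists m, survival x m y < 1) ->
  exists m d, 0 < d /\ forall y, y \in F -> survival x m y <= 1 - d.
Proof.
elim: F => [|a F IH] H; first by exists 0%N, 1.
have [y yF|m [d [d0 md]]] := IH; first by apply: H; rewrite inE yF orbT.
have [m' m'a] := H a (mem_head _ _).
exists (maxn m m'), (Num.min d (1 - survival x m' a)); split.
  by rewrite lt_min d0 subr_gt0.
move=> y; rewrite inE => /predU1P[->|/md yd].
  have := survival_le x _ _ a (leq_maxr m m').
  have := ge_min (1 - survival x m' a) d (1 - survival x m' a); rewrite lexx orbT; lra.
have := survival_le x _ _ y (leq_maxl m m').
have := ge_min d d (1 - survival x m' a); rewrite lexx; lra.
Qed.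

(** The drift hypothesis fails on [F]. There it is repaired by adding to [f] a
  large multiple of the bounded function v = sum_(k < m) survival x k: since
  v = 1 - survival x m + (killed kernel) v, the killed kernel never increases v,
  and decreases it by at least d on [F] once [m] is such that the survival
  probability is at most 1 - d there. The corrected function decreases
  by e everywhere under the killed kernel, and dominates e times every partial
  sum of survival probabilities. *)
Lemma foster_criterion x (f : T -> R) (F : seq T) (e : R) :
  0 < e -> (forall y, 0 <= f y) ->
  (forall y, y \notin F -> step predT f y <= f y - e) ->
  (forall y, y \in F -> exists m, survival x m y < 1) ->
  forall y, exists C, forall n, \sum_(k < n) survival x k y <= C.
Proof.
move=> e0 f0 drift /survival_uniform[m [d [d0 md]]].
(* The one-step expectations are nonnegative: their sum bounds each of them. *)
pose C := \sum_(y <- F) step predT f y.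
have stepC y : y \in F -> step predT f y <= C.
  move=> yF; rewrite /C (perm_big _ (perm_to_rem yF)) big_cons/= lerDl.
  by apply: sumr_ge0 => z _; exact: step_ge0.
have C0 : 0 <= C by apply: sumr_ge0 => z _; exact: step_ge0.
pose v y := \sum_(k < m) survival x k y.
have v0 y : 0 <= v y by apply: sumr_ge0 => k _; exact: survival_ge0.
have stepv y : step (predC1 x) v y = v y + survival x m y - 1.
  by have := survival_sumS x m y; rewrite big_ord_recr/= -/(v y) => ->; rewrite addrC addKr.
pose M := (C + e) / d.
have M0 : 0 <= M by rewrite divr_ge0 ?addr_ge0// ltW.
pose f' y := f y + M * v y.
have f'0 y : 0 <= f' y by rewrite addr_ge0// mulr_ge0.
have drift' y : step (predC1 x) f' y <= f' y - e.
  rewrite stepD stepZ stepv /f'.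
  have le1 := step_le_full (predC1 x) f y f0.
  have [yF|yF] := boolP (y \in F).
    have : M * (1 - survival x m y) >= C + e.
      rewrite -[leLHS](@divfK _ d) ?gt_eqF// -/M ler_wpM2l//.
      have := md _ yF; lra.
    have := stepC _ yF; have := f0 y; nra.
  have := drift _ yF; have := survival_le1 x m y.
  have : 0 <= M * (1 - survival x m y) by rewrite mulr_ge0// subr_ge0 survival_le1.
  nra.
move=> y; exists (f' y / e) => n; rewrite ler_pdivlMr// mulrC.
elim: n y => [|n IH] y; first by rewrite big_ord0 mulr0.
rewrite survival_sumS mulrDr mulr1 -stepZ -lerBrDl.
exact: le_trans (ler_step _ _ _ _ (fun z _ _ => IH z)) (drift' y).
Qed.

(** Optional stopping: as [phi x = 0], killing at [x] loses nothing, so [phi y] is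
  at most the mean of [phi] after [n] steps on the event of survival, where
  [phi] is at most [phi y + n B]. *)
Lemma submartingale_survival x (phi : T -> R) (B : R) : 0 <= B ->
  phi x = 0 -> (forall y, phi y <= step predT phi y) ->
  (forall y z, z \in nb y -> phi z <= phi y + B) ->
  (forall y, 0 <= phi y) ->
  forall n y, phi y <= (phi y + n%:R * B) * survival x n y.
Proof.
move=> B0 phix sub incr phi0 n y.
have step_taboo g z : g x = 0 -> step (predC1 x) g z = step predT g z.
  move=> gx; rewrite /step big_mkcond/=; apply: eq_bigr => u _.
  by case: eqVneq => //= ->; rewrite gx mulr0.
apply: (@le_trans _ _ (iter n (step (predC1 x)) phi y)).
  elim: n y => [|n IH] y //.
  apply: le_trans (ler_step _ _ _ _ (fun z _ _ => IH z)).
  by rewrite step_taboo.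
elim: n y => [|n IH] y; first by rewrite /survival /= mul0r addr0 mulr1.
apply: le_trans (ler_step _ _ _ _ (fun z _ _ => IH z)) _.
rewrite survivalS -stepZ; apply: ler_step => z zy _.
rewrite ler_wpM2r ?survival_ge0// -natr1.
have := incr _ _ zy; nra.
Qed.

(** By [submartingale_survival] the survival probabilities from [y] decrease no
  faster than 1 / n, and the chain started at [x] can be at [y] after [i] steps
  without having returned: compare with the harmonic series. *)
Lemma submartingale_not_summable x (phi : T -> R) (B : R) y i (c : R) :
  0 <= B -> phi x = 0 -> (forall y, phi y <= step predT phi y) ->
  (forall y z, z \in nb y -> phi z <= phi y + B) ->
  (forall y, 0 <= phi y) ->
  0 < phi y -> 0 < c ->
  (forall n, c * survival x n y <= survival x (n + i) x) ->
  ~ exists C, forall n, \sum_(k < n) survival x k x <= C.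
Proof.
move=> B0 phix sub incr phi0 phiy c0 reach [C HC].
pose D := phi y + B; have D0 : 0 < D by rewrite ltr_pwDl.
have low n : c * phi y / D * n.+1%:R^-1 <= survival x (n + i) x.
  apply: le_trans (reach n); rewrite -!mulrA ler_wpM2l ?(ltW c0)//.
  rewrite mulrA ler_pdivrMr ?ltr0n// ler_pdivrMr//.
  apply: le_trans (submartingale_survival _ _ _ B0 phix sub incr phi0 n y) _.
  rewrite mulrC -mulrA ler_wpM2l ?survival_ge0// /D -natr1.
  have : 0 <= n%:R :> R by []. nra.
apply: (@dvg_harmonic R); apply: nondecreasing_is_cvgn.
  apply/nondecreasing_seqP => n; rewrite /series/= big_nat_recr//= lerDl.
  by rewrite /harmonic/= invr_ge0.
exists (C / (c * phi y / D)) => _ [n _ <-].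
rewrite ler_pdivlMr ?divr_gt0 ?mulr_gt0// mulrC /series/= big_mkord big_distrr/=.
apply: le_trans (HC (n + i)%N).
apply: le_trans (ler_sum _ (fun (k : 'I_n) _ => low k)) _.
rewrite addnC big_split_ord/= addrC.
under eq_bigr do rewrite addnC.
by rewrite lerDl; apply: sumr_ge0 => k _; exact: survival_ge0.
Qed.

End KernelTheory.

(** * Path events of the jump chain *)

(** The integral of a nonnegative function is a supremum over simple functions
  below it, hence is monotone without measurability. This matters for
  [return_time], an infimum over uncountably many times. *)
Lemma ge0_le_integral_nonmeasurable {d} {Omega : measurableType d} {R : realType}
    (mu : {measure set Omega -> \bar R}) (f g : Omega -> \bar R) :
  (forall w, 0 <= f w)%E -> (forall w, f w <= g w)%E ->
  (\int[mu]_w f w <= \int[mu]_w g w)%E.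
Proof.
move=> f0 fg; rewrite !ge0_integralTE//; last first.
  by move=> w; exact: le_trans (fg w).
apply: le_ereal_sup => _ [h hf <-]; exists h => // w.
exact: le_trans (hf w) (fg w).
Qed.

Section PathEventDefinitions.
Context {R : realType} {T : countType} {d : measure_display}
  {Omega : measurableType d}.
Variables (nb : T -> seq T) (x : T).
Variables (Y : nat -> Omega -> T) (S : nat -> Omega -> \bar R).

(** The path follows [y] up to step [n], then makes [k] further steps within [A]
  to end in [B], the last holding time exceeding [s]. Positivity of the earlier
  holding times is included because only such events have a known probability. *)
Definition path_event (A B : pred T) (n k : nat) (y : nat -> T) (s : R) :
    set Omega :=
  [set w | [/\ forall i, (i <= n)%N -> Y i w = y i,
    forall i, (i < n + k)%N -> (0 < S i w)%E,
    (s%:E < S (n + k)%N w)%E,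
    forall i, (n <= i < n + k)%N -> Y i.+1 w \in nb (Y i w) /\ A (Y i.+1 w)
    & B (Y (n + k)%N w)]].

Definition path_from (A B : pred T) k s :=
  path_event A B 0 k (fun=> x) s.

Definition extend_path (y : nat -> T) (n : nat) (z : T) : nat -> T :=
  fun i => if (i <= n)%N then y i else z.

End PathEventDefinitions.

Section PathEventLaws.
Context {R : realType} {T : countType} {d : measure_display}
  {Omega : measurableType d} {P : probability Omega R}.
Context {q : T -> T -> R} {nb : T -> seq T} {x : T}.
Context {Y : nat -> Omega -> T} {S : nat -> Omega -> \bar R}.

Local Notation path_event := (path_event nb Y S).
Local Notation path_from := (path_from nb x Y S).

Hypothesis pK : locally_finite_kernel (jump_prob q) nb.
Hypothesis mY : forall n y, measurable [set w | Y n w = y].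
Hypothesis mS : forall n, measurable_fun [set: Omega] (S n).
Hypothesis law : jump_hold_law q P x Y S.

Lemma measurable_holding_gt n (s : \bar R) : measurable [set w | (s < S n w)%E].
Proof. by rewrite -[X in measurable X]setTI; exact: emeasurable_fun_o_infty. Qed.

Lemma path_event0 A B n y s : path_event A B n 0 y s =
  if B (y n) then [set w | forall i, (i <= n)%N ->
     Y i w = y i /\ ((if i == n then s else 0)%:E < S i w)%E] else set0.
Proof.
rewrite /path_event addn0; apply/seteqP; split => w /=.
  move=> [Yy S0 Ss _]; rewrite Yy// => -> i ilen; split; first exact: Yy.
  by case: eqVneq => [->|ni]//; apply: S0; rewrite ltn_neqAle ni.
case: ifP => // By H; split.
- by move=> i /H[].
- move=> i ni; have [_] := H i (ltnW ni); by rewrite ltn_eqF.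
- by have [_] := H n (leqnn n); rewrite eqxx.
- by move=> i; lia.
- by have [-> _] := H n (leqnn n).
Qed.

(** Splitting according to the state at step n + 1. The union is finite because
  the events only admit steps to listed successors. *)
Lemma path_eventS A B n k y s : path_event A B n k.+1 y s =
  \bigcup_(z in [set` [seq z <- nb (y n) | A z]])
     path_event A B n.+1 k (extend_path y n z) s.
Proof.
rewrite /path_event addSnnS; apply/seteqP; split => w /=.
  move=> [Yy S0 Ss Yn BY]; have [] := Yn n; first lia.
  rewrite (Yy n)// => nbn An; exists (Y n.+1 w); first by rewrite /= mem_filter An.
  split => //.
    move=> i ilen; rewrite /extend_path; case: leqP => [/Yy//|ni].
    by have -> : i = n.+1 by lia.
  by move=> i ni; apply: Yn; lia.
move=> [z]; rewrite /= mem_filter => /andP[Az zy] [Yy S0 Ss Yn BY].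
have Yy' i : (i <= n)%N -> Y i w = y i.
  by move=> ilen; rewrite Yy ?/extend_path ?ilen// ltnW.
split => // i; have [->|in_ ilt] := eqVneq i n; last by apply: Yn; lia.
by move=> _; rewrite (Yy n.+1)// Yy'// /extend_path ltnn.
Qed.

(** The law of the jump chain and the holding times prescribes the case k = 0;
  the general case follows by splitting at the first free step. *)
Lemma path_event_law A B n k y s : 0 <= s ->
  measurable (path_event A B n k y s) /\
  P (path_event A B n k y s) =
  ((y 0%N == x)%:R * (\prod_(i < n) jump_prob q (y i) (y i.+1)) *
   iter k (step (jump_prob q) nb A)
     (fun z => (B z)%:R * expR (- (exit_rate q z * s))) (y n))%:E.
Proof.
move=> s0; elim: k n y => [|k IH] n y.
  rewrite path_event0; split; last first.
    case: ifP => By; last by rewrite measure0 /= By !(mul0r,mulr0).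
    rewrite law; last by move=> i; case: ifP.
    rewrite /= By mul1r big_ord_recr/= eqxx [X in _ * (X * _)]big1 ?mul1r// => i _.
    by rewrite ltn_eqF// mulr0 oppr0 expR0.
  case: ifP => // By.
  rewrite (_ : [set w | _] = \bigcap_(i in [set i | (i <= n)%N])
     ([set w | Y i w = y i] `&`
      [set w | ((if i == n then s else 0)%:E < S i w)%E])); last first.
    by apply/seteqP; split => w.
  apply: bigcap_measurableType => i _; apply: measurableI => //.
  exact: measurable_holding_gt.
rewrite path_eventS; split.
  apply: fin_bigcup_measurable => [|z _]; last by case: (IH n.+1 (extend_path y n z)).
  exact: finite_seq.
rewrite measure_fin_bigcup//; last 3 first.
- exact: finite_seq.
- move=> z1 z2 _ _ [w [[Y1 _ _ _ _] [Y2 _ _ _ _]]].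
  by have := Y1 _ (leqnn _); rewrite Y2// /extend_path ltnn.
- by move=> z _; case: (IH n.+1 (extend_path y n z)).
rewrite -fsbig_seq ?filter_uniq ?(nb_uniq pK)// big_filter.
rewrite /= {2}/step big_distrr/= -sumEFin; apply: eq_bigr => z _.
have [_ ->] := IH n.+1 (extend_path y n z).
rewrite /extend_path ltnn leq0n big_ord_recr/= leqnn ltnn.
rewrite (eq_bigr (fun i : 'I_n => jump_prob q (y i) (y i.+1))) ?mulrA// => i _.
by rewrite ltn_ord ltnW.
Qed.

Lemma path_fromE A B k s : path_from A B k s =
  [set w | [/\ Y 0%N w = x, forall i, (i < k)%N -> (0 < S i w)%E,
    (s%:E < S k w)%E,
    forall i, (i < k)%N -> Y i.+1 w \in nb (Y i w) /\ A (Y i.+1 w)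
    & B (Y k w)]].
Proof.
apply/seteqP; split => w [? ? ? ? ?]; split => //.
- exact: (_ : forall i, (i <= 0)%N -> Y i w = x).
- by move=> i; rewrite leqn0 => /eqP->.
Qed.

Lemma measurable_path_from A B k s : 0 <= s -> measurable (path_from A B k s).
Proof. by move=> /(path_event_law A B 0 k (fun=> x))[]. Qed.

Lemma path_from_law A B k s : 0 <= s -> P (path_from A B k s) =
  (iter k (step (jump_prob q) nb A)
     (fun z => (B z)%:R * expR (- (exit_rate q z * s))) x)%:E.
Proof.
move=> /(path_event_law A B 0 k (fun=> x))[_ ->].
by rewrite eqxx big_ord0 !mul1r.
Qed.

End PathEventLaws.

(** * Return times and survival *)

Section NonnegativeSeries.
Context {R : realType}.
Local Open Scope ereal_scope.

Lemma nneseries_le_bound (u : nat -> \bar R) (C : \bar R) :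
  (forall n, 0 <= u n) -> (forall n, \sum_(k < n) u k <= C) ->
  \sum_(k <oo) u k <= C.
Proof.
move=> u0 uC; apply: lime_le; first exact: is_cvg_nneseries.
by apply: nearW => n; rewrite big_mkord.
Qed.

Lemma partial_le_nneseries (u : nat -> \bar R) n : (forall n, 0 <= u n) ->
  \sum_(k < n) u k <= \sum_(k <oo) u k.
Proof. by move=> u0; rewrite -(big_mkord predT u); exact: nneseries_lim_ge. Qed.

Lemma pinfty_of_nat_le (z : \bar R) : (forall n : nat, n%:R%:E <= z) -> z = +oo.
Proof.
move=> nz; apply/eqyP => A A0; apply: le_trans (nz (Num.truncn A).+1).
by rewrite lee_fin ltW// truncnS_gt.
Qed.

(** The right-hand side is [s] rounded up to an integer; it allows the mean of a
  holding time to be bounded using tail events only. *)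
Lemma le_sum_indicators (s : \bar R) :
  s <= \sum_(j <oo) ((j%:R%:E < s)%E%:R)%:E.
Proof.
pose u (j : nat) : \bar R := ((j%:R%:E < s)%E%:R)%:E.
rewrite -[leRHS]/(\sum_(k <oo) u k).
have u0 j : 0 <= u j by rewrite lee_fin.
have part (n : nat) : Order.min n%:R%:E s <= \sum_(k <oo) u k.
  apply: le_trans (partial_le_nneseries u n u0).
  elim: n => [|n IH]; first by rewrite big_ord0 ge_min lexx.
  rewrite big_ord_recr/= {2}/u; have [ns|sn] := ltP n%:R%:E s.
    rewrite ge_min -natr1 EFinD leeD//.
    by move: IH; rewrite min_l// ltW.
  by rewrite adde0 (le_trans _ IH)// ge_min (min_r sn) lexx orbT.
clearbody u; case: s part => [r| |] part; last by rewrite leNye.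
  apply: le_trans (part (Num.truncn r).+1); rewrite le_min lexx andbT.
  by rewrite lee_fin ltW// truncnS_gt.
rewrite (pinfty_of_nat_le (\sum_(k <oo) u k)) ?leey// => n; apply: le_trans (part n).
by rewrite le_min lexx leey.
Qed.

End NonnegativeSeries.

(** An upper bound for the holding time [S k] before the return to [x], written as
  a series of indicators of events of known probability. The null set where the
  path leaves the lists [nb] or has a zero holding time belongs to all these
  events: there the series is infinite, which lets [return_time_le] hold
  at every sample point. *)
Definition path_cost {R : realType} {T : countType} {d : measure_display}
    {Omega : measurableType d} (nb : T -> seq T) (x : T) (Y : nat -> Omega -> T)
    (S : nat -> Omega -> \bar R) (k : nat) (w : Omega) : \bar R :=
  (\sum_(j <oo) (\1_(path_from nb x Y S (predC1 x) predT k j%:R `|`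
     ~` path_from nb x Y S predT predT k 0) w)%:E)%E.

Section ReturnTime.
Context {R : realType} {T : countType} {d : measure_display}
  {Omega : measurableType d} (nb : T -> seq T) (x : T).
Context {Y : nat -> Omega -> T} {S : nat -> Omega -> \bar R}.
Context {X : R -> Omega -> option T}.

Hypothesis S_ge0 : forall n w, (0 <= S n w)%E.
Hypothesis Xpath : forall (t : R) (w : Omega), 0 <= t ->
  (forall n, (jump_time S n w <= t%:E)%E ->
     (t%:E < jump_time S n.+1 w)%E -> X t w = Some (Y n w)) /\
  ((forall n, (jump_time S n w <= t%:E)%E) -> X t w = None).

Lemma jump_timeS n w : (jump_time S n.+1 w = jump_time S n w + S n w)%E.
Proof. by rewrite /jump_time big_ord_recr. Qed.

Lemma jump_time0 w : jump_time S 0 w = 0%E.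
Proof. by rewrite /jump_time big_ord0. Qed.

Lemma le_jump_time m n w : (m <= n)%N -> (jump_time S m w <= jump_time S n w)%E.
Proof.
move=> /subnK <-; elim: (n - m)%N => [|k IH] //.
by rewrite addSn jump_timeS (le_trans IH)// leeDl.
Qed.

Lemma jump_time_ge0 n w : (0 <= jump_time S n w)%E.
Proof. by rewrite -(jump_time0 w) le_jump_time. Qed.

(** The graveyard [None] is the only value of [X] that is not a state of the jump
  chain, and times before explosion lie in exactly one holding interval. *)
Lemma state_of_path t w z : 0 <= t -> X t w = Some z ->
  exists n, [/\ (jump_time S n w <= t%:E)%E, (t%:E < jump_time S n.+1 w)%E
    & Y n w = z].
Proof.
move=> t0 Xt; have [Xn XN] := Xpath t w t0.
have [n nt] : exists n, (t%:E < jump_time S n w)%E.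
  apply: contrapT => /forallNP H; have := XN _; rewrite Xt => /(_ _)/= K.
  suff : Some z = None by [].
  by apply: K => n; rewrite leNgt; exact/negP.
have := ex_minnP (ex_intro (fun n => (t%:E < jump_time S n w)%E) n nt).
case=> -[|m] mt mmin; first by move: mt; rewrite jump_time0 ltNge lee_fin t0.
have mle : (jump_time S m w <= t%:E)%E.
  by rewrite leNgt; apply/negP => /mmin; rewrite ltnn.
exists m; split => //.
by have := Xn m mle mt; rewrite Xt => -[].
Qed.

Local Notation excursion k s :=
  (path_from nb x Y S (predC1 x) predT k s).
Local Notation regular k := (path_from nb x Y S predT predT k 0).
Local Notation path_cost := (path_cost nb x Y S).

(** The holding interval that contains a return time [t] has positive index m, so
  the holding times S_0, ..., S_(m-1) have been spent by then. Each of them that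
  exceeds 1 pays for its indicator, and no indicator of index m or more is 1. *)
Lemma excursion_count_le_return_time n w :
  (\sum_(k < n) (\1_(excursion k 1) w)%:E <= return_time X x w)%E.
Proof.
apply: le_ereal_inf_tmp => _ [t [t0 Xt [s [s0 st Xs]]] <-].
have [m [mt tm Ym]] := state_of_path t w x t0 Xt.
have m0 : (0 < m)%N.
  case: m mt tm Ym => // _ t1 Y0; exfalso; apply: Xs; rewrite -Y0.
  have [H _] := Xpath s w s0; apply: H; first by rewrite jump_time0 lee_fin.
  by apply: lt_trans t1; rewrite lte_fin.
apply: le_trans mt; apply: (@le_trans _ _ (jump_time S (minn n m) w)); last first.
  exact/le_jump_time/geq_minr.
elim: n => [|n IH]; first by rewrite big_ord0 min0n jump_time0.
rewrite big_ord_recr/=; have [nm|mn] := ltnP n m; last first.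
  rewrite (minn_idPr (leqW mn)); move: IH; rewrite (minn_idPr mn) => IH.
  rewrite indicE memNset ?adde0// path_fromE => -[_ _ _ H _].
  have [] := H m.-1; first lia.
  by rewrite prednK// Ym /= eqxx.
rewrite (minn_idPl nm); move: IH; rewrite (minn_idPl (ltnW nm)) jump_timeS => IH.
rewrite leeD// indicE; case: (asboolP (excursion n 1 w)) => [H|H].
  by rewrite mem_set//; move: H; rewrite path_fromE => -[_ _ /ltW + _ _].
by rewrite memNset.
Qed.

Lemma path_cost_ge0 k w : (0 <= path_cost k w)%E.
Proof. by apply: nneseries_ge0 => j _ _; rewrite lee_fin. Qed.

Hypothesis nbx : forall y, y \notin nb y.

Lemma path_cost_irregular k w : ~ regular k w -> path_cost k w = +oo%E.
Proof.
move=> nreg; apply: pinfty_of_nat_le => n.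
apply: le_trans (partial_le_nneseries _ n _); last by move=> j; rewrite lee_fin.
rewrite (eq_bigr (fun=> 1%:E)) ?sumEFin ?sumr_const ?card_ord// => j _.
by rewrite indicE mem_set//; right.
Qed.

Lemma path_cost_excursion k w : excursion k 0 w -> (S k w <= path_cost k w)%E.
Proof.
move=> exc; apply: le_trans (le_sum_indicators _) _; apply: lee_nneseries.
  by move=> j _; rewrite lee_fin.
move=> j _; rewrite lee_fin indicE.
have [jS|//] := boolP (j%:R%:E < S k w)%E.
rewrite mem_set//; left; move: exc; rewrite !path_fromE => -[? ? _ ? ?]; split => //.
Qed.

Lemma path_cost_excursion1 k w : excursion k 0 w -> (1 <= path_cost k w)%E.
Proof.
move=> exc; apply: le_trans (partial_le_nneseries _ 1%N _); last first.
  by move=> j; rewrite lee_fin.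
by rewrite big_ord1 indicE mem_set//; left.
Qed.

(** Let m be the first positive step at which the path is at [x]. Then [X] is at
  [x] at the m-th jump time and was elsewhere at the first jump time, so the
  return time is at most S_0 + ... + S_(m-1). *)
Lemma return_time_le w : (return_time X x w <= \sum_(k <oo) path_cost k w)%E.
Proof.
have partial n := partial_le_nneseries (path_cost^~ w) n (path_cost_ge0 ^~ w).
have [[k nreg]|/forallNP reg'] := pselect (exists k, ~ regular k w).
  by rewrite (nneseries_pinfty _ _ (path_cost_irregular k w nreg)) ?leey// => n _;
    exact: path_cost_ge0.
have reg k : regular k w by exact: contrapT (reg' k).
have Y0 : Y 0%N w = x by have := reg 0%N; rewrite path_fromE => -[].
have Spos k : (0 < S k w)%E by have := reg k; rewrite path_fromE => -[].
have Ynb k : Y k.+1 w \in nb (Y k w).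
  by have := reg k.+1; rewrite path_fromE => -[_ _ _ /(_ k (ltnSn k))[]].
have exc k : (forall i, (0 < i <= k)%N -> Y i w <> x) -> excursion k 0 w.
  move=> Yx; rewrite path_fromE; split => // i ik; split => //.
  by apply/eqP; exact: Yx.
(* A path which never returns has infinite cost: each term is at least 1. *)
have [[n]|/forallNP never] := pselect (exists n, (0 < n)%N && (Y n w == x)); last first.
  rewrite (pinfty_of_nat_le (\sum_(k <oo) _)%E) ?leey// => n.
  apply: le_trans (partial n).
  rewrite -[n in leLHS]card_ord -sumr_const -sumEFin; apply: lee_sum => k _.
  apply/path_cost_excursion1/exc => i /andP[i0 _] Yi; apply: (never i).
  by rewrite i0 Yi eqxx.
move=> nret; have := ex_minnP (ex_intro (fun n => (0 < n)%N && (Y n w == x)) n nret).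
move=> [m /andP[m0 /eqP Ym] mmin].
apply: (@le_trans _ _ (jump_time S m w)); last first.
  apply: le_trans (partial m); apply: lee_sum => k _.
  apply/path_cost_excursion/exc => i /andP[i0 ik] Yi.
  by have := mmin i; rewrite i0 Yi eqxx => /(_ isT); have := ltn_ord k; lia.
(* A return at step 1 is excluded as x is not its own successor. *)
have m2 : (1 < m)%N.
  case: m m0 Ym {mmin} => [|[|m]]// _ Y1; have := nbx x.
  by have := Ynb 0%N; rewrite Y1 Y0 => ->.
have := jump_time_ge0 m w; case Et : (jump_time S m w) => [t| |]//; rewrite ?leey// lee_fin => t0.
apply: ge_ereal_inf; exists t%:E => //; exists t => //; split => //.
  have [H _] := Xpath t w t0; rewrite (H m) ?Ym ?Et//.
  by rewrite jump_timeS Et lteDl.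
have le1 : (jump_time S 2 w <= t%:E)%E by rewrite -Et le_jump_time.
have fin1 : jump_time S 1 w \is a fin_num.
  rewrite ge0_fin_numE ?jump_time_ge0// (@le_lt_trans _ _ t%:E) ?ltry//.
  by apply: le_trans le1; exact: le_jump_time.
have lt12 : (jump_time S 1 w < jump_time S 2 w)%E.
  by rewrite (jump_timeS 1) lteDl.
exists (fine (jump_time S 1 w)); split.
- by rewrite fine_ge0// jump_time_ge0.
- by rewrite -lte_fin fineK// (lt_le_trans lt12).
- have [|H _] := Xpath (fine (jump_time S 1 w)) w; first by rewrite fine_ge0// jump_time_ge0.
  rewrite (H 1%N) ?fineK// => -[Y1]; have := nbx x.
  by have := Ynb 0%N; rewrite Y1 Y0 => ->.
Qed.

End ReturnTime.

Section MinimalProcessOfJumpChain.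
Context {R : realType} {T : countType} {d : measure_display}
  {Omega : measurableType d} {P : probability Omega R}.
Context {q : T -> T -> R} {nb : T -> seq T} {x : T}.
Context {X : R -> Omega -> option T} {qlo qhi : R}.
Hypothesis pK : locally_finite_kernel (jump_prob q) nb.
Hypothesis qlo_gt0 : 0 < qlo.
Hypothesis exit_bounds : forall y, qlo <= exit_rate q y <= qhi.
Hypothesis X_minimal : minimal_process q P x X.

Local Notation p := (jump_prob q).

(** Almost every path follows the listed successors with positive holding
  times: these events have total mass one. *)
Lemma irregular_prob0 Y S k (mY : forall n y, measurable [set w | Y n w = y])
    (mS : forall n, measurable_fun [set: Omega] (S n))
    (law : jump_hold_law q P x Y S) :
  P (~` path_from nb x Y S predT predT k 0) = 0%E.
Proof.
rewrite probability_setC; last first.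
  exact: (measurable_path_from pK mY mS law).
rewrite (path_from_law pK)// [X in (_ - X%:E)%E](_ : _ = 1) ?subee//.
rewrite -[RHS](iter_step_cst pK 1 k x); congr (iter _ _ _ _).
by apply/funext => z; rewrite mulr0 oppr0 expR0 mulr1.
Qed.

Lemma holding_tail y (s : R) : 0 <= s ->
  expR (- (exit_rate q y * s)) <= expR (- (qlo * s)).
Proof.
by move=> s0; have /andP[lo _] := exit_bounds y; rewrite ler_expR lerN2 ler_wpM2r.
Qed.

Lemma holding_geometric : 0 < expR (- qlo) < 1.
Proof. by rewrite expR_gt0 expR_lt1 oppr_lt0. Qed.

(** A holding time has probability at least exp(-qhi) of exceeding 1,
  independently of the path. *)
Lemma summable_survival_of_integrable :
  (\int[P]_w return_time X x w < +oo)%E ->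
  exists C, forall n, \sum_(k < n) survival p nb x k x <= C.
Proof.
case: X_minimal => Y [S [mY mS S0 law Xpath]].
set I := (\int[P]_w _)%E => Ioo.
have ret0 w : (0 <= return_time X x w)%E.
  have := excursion_count_le_return_time nb x S0 Xpath 0 w.
  by rewrite big_ord0.
have I0 : (0 <= I)%E by apply: integral_ge0 => w _; exact: ret0.
exists (fine I * expR qhi) => n.
have mexc k : measurable (path_from nb x Y S (predC1 x) predT k 1).
  exact: (measurable_path_from pK mY mS law).
rewrite -ler_pdivrMr ?expR_gt0// -expRN mulrC big_distrr/=.
rewrite -lee_fin fineK ?ge0_fin_numE//.
apply: (@le_trans _ _ (\int[P]_w
    (\sum_(k < n) (\1_(path_from nb x Y S (predC1 x) predT k 1) w)%:E))%E).
  rewrite ge0_integral_sum//; last first.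
    by move=> k; apply/measurable_EFinP; exact: measurable_indic.
  rewrite -sumEFin; apply: lee_sum => k _; rewrite integral_indic// setIT.
  rewrite [leRHS](path_from_law pK)// lee_fin.
  apply: (iter_step_survival_ge pK) => z; rewrite mul1r mulr1.
  by have /andP[_ hi] := exit_bounds z; rewrite ler_expR lerN2.
apply: ge0_le_integral_nonmeasurable => w.
  by apply: sume_ge0 => k _; rewrite lee_fin.
exact: excursion_count_le_return_time.
Qed.

(** The [j]-th indicator of [path_cost] at step [k] has probability at most
  exp(-qlo)^j times the survival probability, and the geometric series over [j]
  converges. *)
Lemma integrable_of_summable_survival :
  (exists C, forall n, \sum_(k < n) survival p nb x k x <= C) ->
  (\int[P]_w return_time X x w < +oo)%E.
Proof.
case: X_minimal => Y [S [mY mS S0 law Xpath]] [C HC].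
have /andP[z0 z1] := holding_geometric; set z := expR (- qlo) in z0 z1.
have mevent k j : measurable (path_from nb x Y S (predC1 x) predT k j%:R `|`
    ~` path_from nb x Y S predT predT k 0).
  apply: measurableU.
    exact: (measurable_path_from pK mY mS law).
  by apply: measurableC; exact: (measurable_path_from pK mY mS law).
have ret0 w : (0 <= return_time X x w)%E.
  have := excursion_count_le_return_time nb x S0 Xpath 0 w.
  by rewrite big_ord0.
have le_ret w := return_time_le nb x S0 Xpath (nb_irreflexive pK) w.
apply: (@le_lt_trans _ _ (\int[P]_w \sum_(k <oo) path_cost nb x Y S k w)%E).
  exact: ge0_le_integral_nonmeasurable.
have mcost k : measurable_fun setT (path_cost nb x Y S k).
  apply: ge0_emeasurable_sum => [j w _ _|j _]; first by rewrite lee_fin.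
  by apply/measurable_EFinP; exact: measurable_indic.
rewrite integral_nneseries//; last by move=> k w _; exact: path_cost_ge0.
apply: (@le_lt_trans _ _ (C * (1 - z)^-1)%:E); last exact: ltry.
have cost_le k :
    (\int[P]_w path_cost nb x Y S k w <= (survival p nb x k x / (1 - z))%:E)%E.
  rewrite integral_nneseries//; last first.
    by move=> j; apply/measurable_EFinP; exact: measurable_indic.
  apply: nneseries_le_bound => [j|n].
    by apply: integral_ge0 => w _; rewrite lee_fin.
  apply: le_trans (_ : ((\sum_(j < n) z ^+ j * survival p nb x k x)%:E <= _)%E).
    rewrite -sumEFin; apply: lee_sum => j _; rewrite integral_indic// setIT.
    rewrite measureU0//; last 3 first.
    - exact: (measurable_path_from pK mY mS law).
    - by apply: measurableC; exact: (measurable_path_from pK mY mS law).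
    - exact: (irregular_prob0 Y S).
    rewrite [leLHS](path_from_law pK)// lee_fin.
    apply: (iter_step_survival_le pK) => y; rewrite mul1r.
    apply: le_trans (holding_tail y _ _) _ => //.
    by rewrite /z -expRM_natl mulrN mulrC.
  rewrite lee_fin -big_distrl/= mulrC ler_wpM2l ?(survival_ge0 pK)//.
  have := @geometric_le_lim R n 1 z ler01 z0; rewrite gtr0_norm// => /(_ z1).
  by rewrite mul1r /series/= big_mkord (eq_bigr (fun j : 'I_n => z ^+ j))// => j _; rewrite mul1r.
apply: nneseries_le_bound => [k|n].
  by apply: integral_ge0 => w _; exact: path_cost_ge0.
apply: le_trans (lee_sum _ (fun (k : 'I_n) _ => cost_le k)) _.
rewrite sumEFin lee_fin -big_distrl/=.
by apply: ler_wpM2r; [rewrite invr_ge0 subr_ge0 ltW|exact: HC].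
Qed.

Lemma measurable_state t y : 0 <= t -> measurable [set w | X t w = Some y].
Proof.
case: X_minimal => Y [S [mY mS S0 law Xpath]] t0.
have mT n : measurable_fun [set: Omega] (jump_time S n).
  exact: emeasurable_sum.
rewrite (_ : [set w | _] = \bigcup_n (~` [set w | (t%:E < jump_time S n w)%E] `&`
    [set w | (t%:E < jump_time S n.+1 w)%E] `&` [set w | Y n w = y])); last first.
  apply/seteqP; split => w /=.
    move=> /(state_of_path Xpath t w y t0)[n [nt tn Yn]].
    by exists n => //; split => //; split => //; apply/negP; rewrite -leNgt.
  move=> [n _ [[/negP]]]; rewrite -leNgt /= => nt tn <-.
  by have [H _] := Xpath t w t0; exact: H.
apply: bigcupT_measurable => n; apply: measurableI => //; apply: measurableI.
  by apply: measurableC; rewrite -[X in measurable X]setTI; exact: emeasurable_fun_o_infty.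
by rewrite -[X in measurable X]setTI; exact: emeasurable_fun_o_infty.
Qed.

Lemma holding_finite_ae Y S k (mY : forall n y, measurable [set w | Y n w = y])
    (mS : forall n, measurable_fun [set: Omega] (S n))
    (law : jump_hold_law q P x Y S) :
  P.-negligible [set w | S k w = +oo%E].
Proof.
have mE : measurable [set w | S k w = +oo%E].
  rewrite -[X in measurable X]setTI.
  exact: (mS k measurableT [set +oo%E] (emeasurable_set1 _)).
have mreg j : measurable (path_from nb x Y S predT predT k j%:R).
  exact: (measurable_path_from pK mY mS law).
apply/negligibleP => //; apply/eqP; rewrite -measure_le0.
rewrite -[leLHS]fineK ?fin_num_measure// lee_fin leNgt; apply/negP => v0.
set v := fine _ in v0; have /andP[z0 z1] := holding_geometric.
have /cvgr0Pnorm_lt/(_ v v0)[N _ /(_ N (leqnn N))] : (expR (- qlo) ^+ n @[n --> \oo] --> 0).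
  by apply: cvg_expr; rewrite gtr0_norm.
rewrite ger0_norm ?exprn_ge0 ?expR_ge0// ltNge => /negP; apply.
rewrite -lee_fin fineK ?fin_num_measure//.
have le1 : (P [set w | S k w = +oo%E] <=
    P (path_from nb x Y S predT predT k N%:R `|`
       ~` path_from nb x Y S predT predT k 0))%E.
  rewrite le_measure ?inE//.
    apply: measurableU; first exact: mreg.
    by apply: measurableC; exact: (mreg 0%N).
  move=> w /= Sw; have [reg|nreg] := pselect (path_from nb x Y S predT predT k 0 w).
    left; move: reg; rewrite !path_fromE => -[? ? _ ? ?]; split => //.
    by rewrite Sw ltry.
  by right.
apply: le_trans le1 _; rewrite measureU0//.
- rewrite [leLHS](path_from_law pK)// lee_fin.
  rewrite -[leRHS](iter_step_cst pK _ k x).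
  elim: k x {mE mreg v v0} => [|k IH] y /=.
    by rewrite mul1r (le_trans (holding_tail y _ _))// -expRM_natl mulrN mulrC.
  by apply: (ler_step pK) => z _ _; exact: IH.
- by apply: measurableC; exact: (mreg 0%N).
- exact: (irregular_prob0 Y S).
Qed.

(** With positive probability the chain is at [y] after [m] jumps. Then [X] is at
  [y] during a time interval of positive length, almost surely starting at a
  finite time, hence at some rational time; one of these countably many times
  must have positive probability. *)
Lemma accessible_of_leads_to y : leads_to p nb x y ->
  exists2 t : R, 0 <= t & (0 < P [set w | X t w = Some y])%E.
Proof.
move=> [m my]; case: (X_minimal) => Y [S [mY mS S0 law Xpath]].
apply: contrapT => noT.
have null t : 0 <= t -> P.-negligible [set w | X t w = Some y].
  move=> t0; apply/negligibleP; first exact: measurable_state.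
  apply/eqP; rewrite -measure_le0 leNgt; apply/negP => Pt.
  by apply: noT; exists t.
pose E := path_from nb x Y S predT (pred1 y) m 0.
have mE : measurable E by exact: (measurable_path_from pK mY mS law).
pose F (k : nat) : set Omega :=
  if unpickle k is Some r then
    if 0 <= ratr r :> R then [set w | X (ratr r) w = Some y] else set0
  else set0.
have : P.-negligible E.
  suff sub : E `<=` (\bigcup_k F k) `|` \bigcup_k [set w | S k w = +oo%E].
    apply: (negligibleS sub).
    apply: negligibleU; apply: negligible_bigcup => k; last first.
      exact: (holding_finite_ae Y S).
    rewrite /F; case: unpickle => [r|]; last exact: negligible_set0.
    by case: ifP => [/null//|_]; exact: negligible_set0.
  move=> w Ew; have [[k Sk]|/forallNP Sfin] := pselect (exists k, S k w = +oo%E).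
    by right; exists k.
  left; move: Ew; rewrite /E path_fromE => -[_ _ Sm _ /eqP Ym].
  have Tfin n : jump_time S n w \is a fin_num.
    rewrite ge0_fin_numE ?jump_time_ge0//; apply: lte_sum_pinfty => i _.
    by rewrite ltey; apply/eqP; exact: Sfin.
  have Sm_fin : S m w \is a fin_num by rewrite ge0_fin_numE// ltey; apply/eqP; exact: Sfin.
  have [r] : exists r : rat, ratr r \in
      `](fine (jump_time S m w)), (fine (jump_time S m w) + fine (S m w))[.
    by apply: rat_in_itvoo; rewrite ltrDl -lte_fin fineK.
  rewrite in_itv/= => /andP[Tr rT].
  have r0 : 0 <= ratr r :> R.
    by rewrite (le_trans _ (ltW Tr))// fine_ge0// jump_time_ge0.
  have FrE : F (pickle r) = [set w | X (ratr r) w = Some y].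
    by rewrite /F pickleK r0.
  exists (pickle r); first exact: I.
  rewrite FrE -Ym.
  have [H _] := Xpath (ratr r) w r0; apply: H.
    by rewrite -(fineK (Tfin m)) lee_fin ltW.
  by rewrite jump_timeS -(fineK (Tfin m)) -(fineK Sm_fin) -EFinD lte_fin.
have PE := path_from_law pK mY mS law predT (pred1 y) m 0 (lexx 0).
move=> /(measure_negligible mE)/(etrans (esym PE))/eqP; rewrite eqe.
rewrite (_ : (fun _ => _) = (fun z => (z == y)%:R)); first by rewrite gt_eqF.
by apply/funext => z; rewrite mulr0 oppr0 expR0 mulr1.
Qed.

End MinimalProcessOfJumpChain.

(** * The test functions *)

Definition arrival (y : nat * nat) := (y.1.+1, y.2).
Definition transfer (y : nat * nat) := (y.1.-1, y.2.+1).
Definition departure (y : nat * nat) := (y.1, y.2.-1).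

(** On the edge x1 = 0 the list contains a transfer of rate zero, and on the edge
  x2 = 0 the truncated departure is [y] itself, which the filter removes. *)
Definition tandem_nb (y : nat * nat) :=
  [seq z <- [:: arrival y; transfer y; departure y] | z != y].

Section TandemDefinitions.
Context {R : realType}.
Variables (lambda : nat -> R) (mu1 mu2 : R) (K : nat).

Definition transfer_rate (y : nat * nat) : R :=
  if (1 <= y.1)%N then mu1 else 0.
Definition departure_rate (y : nat * nat) : R :=
  if (1 <= y.2)%N then mu2 else 0.
Definition total_rate (y : nat * nat) : R :=
  lambda y.2 + transfer_rate y + departure_rate y.

Definition rate_min : R := Num.min (lambda 0) (Num.min mu1 mu2).
Definition rate_max : R := \sum_(k < K.+1) lambda k + mu1 + mu2.

Definition generator (f : nat * nat -> R) (y : nat * nat) : R :=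
  lambda y.2 * (f (arrival y) - f y) + transfer_rate y * (f (transfer y) - f y)
  + departure_rate y * (f (departure y) - f y).

(** The increments of the function of the second queue which, added to the length
  of the first queue, has constant drift [theta - mu1] wherever the first queue
  is nonempty. *)
Fixpoint slope (theta : R) (n : nat) : R :=
  if n is m.+1 then (mu2 * slope theta m + theta - lambda m.+1) / mu1
  else (theta - lambda 0) / mu1.

Definition height (theta : R) (n : nat) : R := \sum_(j < n) slope theta j.

Definition potential (theta : R) (y : nat * nat) : R :=
  y.1%:R + height theta y.2.

(** The mean of [lambda] under the geometric law of parameter [rho], when [lambda]
  vanishes beyond [K]. *)
Definition geometric_mean (rho : R) : R :=
  (1 - rho) * \sum_(k < K.+1) rho ^+ k * lambda k.

End TandemDefinitions.

Arguments slope : simpl never.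

Section SlopeRecursion.
Context {R : realType} {lambda : nat -> R} {mu1 mu2 : R} {K : nat}.
Hypothesis lambda_ge0 : forall n, 0 <= lambda n.
Hypothesis mu1_gt0 : 0 < mu1.
Hypothesis mu2_gt0 : 0 < mu2.
Hypothesis lambda_vanishes : forall n, (K < n)%N -> lambda n = 0.

Local Notation slope := (slope lambda mu1 mu2).
Local Notation height := (height lambda mu1 mu2).
Local Notation geometric_mean := (geometric_mean lambda K).

Lemma heightS theta n : height theta n.+1 = height theta n + slope theta n.
Proof. by rewrite /height big_ord_recr. Qed.

Lemma slope0 theta : mu1 * slope theta 0 = theta - lambda 0.
Proof. by rewrite mulrC; exact: divfK (lt0r_neq0 mu1_gt0) _. Qed.

Lemma slope_rec theta n : mu1 * slope theta n.+1 = mu2 * slope theta n + theta - lambda n.+1.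
Proof. by rewrite mulrC; exact: divfK (lt0r_neq0 mu1_gt0) _. Qed.

Lemma slope_closed_form theta (rho : R) n : rho * mu2 = mu1 ->
  mu1 * (rho ^+ n * slope theta n) = \sum_(k < n.+1) rho ^+ k * (theta - lambda k).
Proof.
move=> rhoE; elim: n => [|n IH].
  by rewrite big_ord_recl big_ord0 !expr0 !mul1r addr0 slope0.
rewrite big_ord_recr -IH/= exprS.
have := slope_rec theta n; move: (slope theta n.+1) (slope theta n) => s' s E.
rewrite mulrCA E -rhoE; ring.
Qed.

Lemma slope_geometric theta (rho : R) n : rho * mu2 = mu1 -> (K <= n)%N ->
  (1 - rho) * (mu1 * (rho ^+ n * slope theta n)) =
  theta - geometric_mean rho - theta * rho ^+ n.+1.
Proof.
move=> rhoE Kn; rewrite (slope_closed_form _ _ _ rhoE) /geometric_mean.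
have -> : \sum_(k < K.+1) rho ^+ k * lambda k = \sum_(k < n.+1) rho ^+ k * lambda k.
  rewrite -(subnK Kn); elim: (n - K)%N => [|k IH] //.
  rewrite addSn [RHS]big_ord_recr/= -IH lambda_vanishes ?mulr0 ?addr0//.
  by rewrite ltnS leq_addl.
have -> : \sum_(k < n.+1) rho ^+ k * (theta - lambda k) =
    (\sum_(k < n.+1) rho ^+ k) * theta - \sum_(k < n.+1) rho ^+ k * lambda k.
  by rewrite big_distrl/= -sumrB; apply: eq_bigr => k _; rewrite mulrBr.
have geo : (1 - rho) * (\sum_(k < n.+1) rho ^+ k) = 1 - rho ^+ n.+1.
  by rewrite -opprB mulNr -subrX1 opprB.
rewrite mulrBr mulrA geo; ring.
Qed.

(** For [theta] equal to the geometric mean the exponentially growing mode of the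
  recursion is absent, and the slope is constant from [K] on. *)
Lemma slope_stationary (rho : R) n : rho * mu2 = mu1 -> rho < 1 -> (K <= n)%N ->
  slope (geometric_mean rho) n = - (geometric_mean rho * rho / ((1 - rho) * mu1)).
Proof.
move=> rhoE rho1 Kn.
have rho0 : 0 < rho by rewrite -(pmulr_lgt0 _ mu2_gt0) rhoE.
have := slope_geometric (geometric_mean rho) rho n rhoE Kn.
rewrite subrr sub0r exprS => E.
have nz1 : 1 - rho != 0 by rewrite lt0r_neq0// subr_gt0.
have nz2 : mu1 != 0 by rewrite lt0r_neq0.
have nz : (1 - rho) * mu1 != 0 by rewrite mulf_neq0.
have nzp : rho ^+ n != 0 by rewrite expf_neq0// lt0r_neq0.
apply: (mulfI nz); apply: (mulfI nzp).
transitivity ((1 - rho) * (mu1 * (rho ^+ n * slope (geometric_mean rho) n))).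
  by ring.
by rewrite E; field; rewrite ?nz1 ?nz2.
Qed.

(** Above the geometric mean the exponentially growing mode has a positive
  coefficient: in [slope_geometric] the last term tends to zero. *)
Lemma slope_eventually_gt0_subcritical (rho theta : R) : rho * mu2 = mu1 -> rho < 1 ->
  geometric_mean rho < theta ->
  exists N delta, 0 < delta /\ forall n, (N <= n)%N -> delta <= slope theta n.
Proof.
move=> rhoE rho1 Eth.
have rho0 : 0 < rho by rewrite -(pmulr_lgt0 _ mu2_gt0) rhoE.
have th0 : 0 < theta.
  apply: le_lt_trans Eth; apply: mulr_ge0; first by rewrite subr_ge0 ltW.
  by apply: sumr_ge0 => k _; rewrite mulr_ge0// exprn_ge0// ltW.
pose gap := theta - geometric_mean rho.
have gap0 : 0 < gap by rewrite subr_gt0.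
have [N HN] : exists N, forall n, (N <= n)%N -> theta * rho ^+ n <= gap / 2.
  have /cvgr0Pnorm_lt/(_ (gap / 2 / theta)) :
      (rho ^+ n @[n --> \oo] --> 0) by apply: cvg_expr; rewrite gtr0_norm.
  rewrite !divr_gt0// => /(_ isT)[N _ HN]; exists N => n /HN/=.
  rewrite gtr0_norm ?exprn_gt0// ltr_pdivlMr// mulrC => /ltW; exact.
(* As rho ^+ n <= 1, a positive slope is at least its product by rho ^+ n. *)
pose D := (1 - rho) * mu1.
have D0 : 0 < D by rewrite mulr_gt0// subr_gt0.
exists (maxn N K), (gap / 2 / D); split; first by rewrite !divr_gt0.
move=> n nN; have := slope_geometric theta rho n rhoE _.
move=> /(_ ltac:(lia)) E; rewrite ler_pdivrMr//.
have le2 : gap / 2 <= D * (rho ^+ n * slope theta n).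
  rewrite /D -mulrA E -/gap; have := HN n.+1 ltac:(lia); lra.
have pn : 0 < rho ^+ n by rewrite exprn_gt0.
have pn1 : rho ^+ n <= 1 by rewrite exprn_ile1// ltW.
have s0 : 0 < slope theta n.
  rewrite -(pmulr_rgt0 _ pn) -(pmulr_rgt0 _ D0); apply: lt_le_trans le2.
  by rewrite divr_gt0.
apply: le_trans le2 _; rewrite mulrC ler_pM2r//.
by rewrite ler_piMl// ltW.
Qed.

(** Beyond [K] the recursion is s |-> (mu2 / mu1) s + theta / mu1 with factor at
  most 1: a negative slope increases by at least theta / mu1 at each
  step, and a nonnegative one is followed by slopes of at least theta / mu1. *)
Lemma slope_eventually_gt0_transient theta : mu2 <= mu1 -> 0 < theta ->
  exists N delta, 0 < delta /\ forall n, (N <= n)%N -> delta <= slope theta n.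
Proof.
move=> mu21 th0; pose u := theta / mu1.
have u0 : 0 < u by rewrite divr_gt0.
have rec n : (K <= n)%N -> slope theta n.+1 = mu2 / mu1 * slope theta n + u.
  move=> Kn; apply: (mulfI (lt0r_neq0 mu1_gt0)).
  rewrite slope_rec lambda_vanishes ?ltnS// /u; field; exact: lt0r_neq0.
have r0 : 0 < mu2 / mu1 by rewrite divr_gt0.
have r1 : mu2 / mu1 <= 1 by rewrite ler_pdivrMr ?mul1r.
move: (mu2 / mu1) r0 r1 rec => r r0 r1 rec.
have low j : Num.min (slope theta K + j%:R * u) 0 <= slope theta (K + j)%N.
  elim: j => [|j IH]; first by rewrite mul0r addr0 addn0 ge_min lexx.
  rewrite addnS rec ?leq_addr//; set s := slope theta (K + j)%N in IH *.
  have rs : Num.min s 0 <= r * s.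
    rewrite ge_min; case: (leP 0 s) => s0; apply/orP.
      by right; rewrite mulr_ge0// ltW.
    by left; nra.
  move: IH rs; rewrite -natr1 !ge_min => /orP[h|h] /orP[h'|h']; apply/orP.
  - by left; lra.
  - by right; lra.
  - by right; lra.
  - by right; lra.
pose J := (Num.truncn (`|slope theta K| / u)).+1.
exists (K + J).+1, u; split => // -[//|n] Jn.
rewrite rec; last lia.
have -> : n = (K + (n - K))%N by lia.
rewrite lerDr mulr_ge0 ?(ltW r0)//.
apply: le_trans (low _); rewrite le_min lexx andbT.
have : `|slope theta K| / u <= (n - K)%:R.
  rewrite ltW// (lt_le_trans (truncnS_gt _))// ler_nat -/J; lia.
rewrite ler_pdivrMr//; have := ler_norm (- slope theta K); rewrite normrN; lra.
Qed.

End SlopeRecursion.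

(** * The tandem queue *)

Section TandemQueue.
Context {R : realType} {lambda : nat -> R} {mu1 mu2 : R} {K : nat}.
Hypothesis lambda_ge0 : forall n, 0 <= lambda n.
Hypothesis lambda0_gt0 : 0 < lambda 0%N.
Hypothesis mu1_gt0 : 0 < mu1.
Hypothesis mu2_gt0 : 0 < mu2.
Hypothesis lambda_vanishes : forall n, (K < n)%N -> lambda n = 0.

Local Notation rate := (system_rate lambda mu1 mu2).
Local Notation transfer_rate := (transfer_rate mu1).
Local Notation departure_rate := (departure_rate mu2).
Local Notation total_rate := (total_rate lambda mu1 mu2).
Local Notation rate_min := (rate_min lambda mu1 mu2).
Local Notation rate_max := (rate_max lambda mu1 mu2 K).
Local Notation generator := (generator lambda mu1 mu2).
Local Notation slope := (slope lambda mu1 mu2).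
Local Notation height := (height lambda mu1 mu2).
Local Notation potential := (potential lambda mu1 mu2).
Local Notation geometric_mean := (geometric_mean lambda K).

Lemma transfer_rate_ge0 y : 0 <= transfer_rate y.
Proof. by rewrite /transfer_rate; case: ifP => // _; exact: ltW. Qed.

Lemma departure_rate_ge0 y : 0 <= departure_rate y.
Proof. by rewrite /departure_rate; case: ifP => // _; exact: ltW. Qed.

Lemma system_rate_arrival y : rate y (arrival y) = lambda y.2.
Proof. by rewrite /system_rate eqxx. Qed.

Lemma system_rate_transfer y : rate y (transfer y) = transfer_rate y.
Proof.
rewrite /system_rate /transfer_rate /transfer !xpair_eqE eqxx.
rewrite (_ : (y.1.-1 == y.1.+1) = false) /=; last by apply/eqP; lia.
rewrite (_ : (y.2.+1 == y.2.-1) = false) /=; last by apply/eqP; lia.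
by rewrite eqxx !andbF andbT.
Qed.

Lemma system_rate_departure y : rate y (departure y) = departure_rate y.
Proof.
rewrite /system_rate /departure_rate /departure !xpair_eqE eqxx.
rewrite (_ : (y.1 == y.1.+1) = false) /=; last by apply/eqP; lia.
rewrite (_ : (y.2.-1 == y.2.+1) = false) /=; last by apply/eqP; lia.
by rewrite eqxx !andbF andbT.
Qed.

Lemma system_rate_ge0 y z : 0 <= rate y z.
Proof. by rewrite /system_rate; do 3?[case: ifP => _] => //; exact: ltW. Qed.

Lemma system_rate_eq0 y z : z \notin [:: arrival y; transfer y; departure y] ->
  rate y z = 0.
Proof.
rewrite !inE !negb_or => /and3P[/negPf z1 /negPf z2 /negPf z3].
rewrite /system_rate -[(y.1.+1, y.2)]/(arrival y) z1.
by rewrite -[(y.1.-1, _)]/(transfer y) z2 -[(y.1, y.2.-1)]/(departure y) z3 !andbF.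
Qed.

Lemma arrival_neq y : arrival y != y.
Proof. by case: y => a b; rewrite xpair_eqE /=; apply/negP; lia. Qed.

Lemma transfer_neq y : transfer y != y.
Proof. by case: y => a b; rewrite xpair_eqE /=; apply/negP; lia. Qed.

Lemma departure_neq y : (departure y != y) = (1 <= y.2)%N.
Proof. by case: y => a b; rewrite xpair_eqE /= eqxx /=; lia. Qed.

Lemma tandem_nb_uniq y : uniq (tandem_nb y).
Proof.
case: y => a b; apply: filter_uniq; rewrite /= !inE !xpair_eqE /=.
by rewrite andbT; lia.
Qed.

Lemma tandem_nb_irreflexive y : y \notin tandem_nb y.
Proof. by rewrite mem_filter eqxx. Qed.

Lemma sum_rate (f : nat * nat -> R) y : \sum_(z <- tandem_nb y) rate y z * f z =
  lambda y.2 * f (arrival y) + transfer_rate y * f (transfer y)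
  + departure_rate y * f (departure y).
Proof.
rewrite /tandem_nb big_filter !big_cons big_nil arrival_neq transfer_neq.
rewrite departure_neq system_rate_arrival system_rate_transfer.
rewrite system_rate_departure /departure_rate.
by case: (1 <= y.2)%N; rewrite ?mul0r /= !addr0 ?addrA.
Qed.

Lemma tandem_exit_rate y : exit_rate rate y = total_rate y.
Proof.
have r0 (z : nat * nat) : (0 <= (rate y z)%:E)%E by rewrite lee_fin system_rate_ge0.
rewrite /exit_rate (esumID [set` tandem_nb y])//.
rewrite [X in (_ + X)%E]esum1 ?adde0; last first.
  move=> z [/= zy znb]; rewrite system_rate_eq0//; apply/negP => zin; apply: znb.
  by rewrite mem_filter zin andbT.
rewrite (_ : _ `&` _ = [set` tandem_nb y]); last first.
  by apply/seteqP; split => z /=; [case|rewrite mem_filter => /andP[zy zin]; rewrite zy zin].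
rewrite esum_fset//; last exact: finite_seq.
rewrite -fsbig_seq ?tandem_nb_uniq// sumEFin /=.
have := sum_rate (fun=> 1) y; rewrite !mulr1 /total_rate => <-.
by apply: eq_bigr => z _; rewrite mulr1.
Qed.

Lemma rate_min_gt0 : 0 < rate_min.
Proof. by rewrite !lt_min lambda0_gt0 mu1_gt0. Qed.

Lemma lambda_le_sum n : lambda n <= \sum_(k < K.+1) lambda k.
Proof.
have [nK|Kn] := leqP n K.
  rewrite (bigD1 (inord n))//= inordK// lerDl.
  by apply: sumr_ge0 => k _; exact: lambda_ge0.
by rewrite lambda_vanishes//; apply: sumr_ge0 => k _; exact: lambda_ge0.
Qed.

Lemma total_rate_bounds y : rate_min <= total_rate y <= rate_max.
Proof.
have l0 := lambda_ge0 y.2; have r1 := transfer_rate_ge0 y; have r2 := departure_rate_ge0 y.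
have lK := lambda_le_sum y.2.
have [m0 m1 m2] : [/\ rate_min <= lambda 0, rate_min <= mu1 & rate_min <= mu2].
  by rewrite /rate_min !ge_min !lexx !orbT.
apply/andP; split; last first.
  rewrite /total_rate /rate_max lerD ?lerD//.
    by rewrite /transfer_rate; case: ifP => // _; exact: ltW.
  by rewrite /departure_rate; case: ifP => // _; exact: ltW.
move: r1 r2 l0; rewrite /total_rate /transfer_rate /departure_rate.
by case: y {lK} => -[|a] [|b] /=; lra.
Qed.

Lemma total_rate_gt0 y : 0 < total_rate y.
Proof.
by have /andP[lo _] := total_rate_bounds y; exact: lt_le_trans rate_min_gt0 lo.
Qed.

Lemma rate_max_gt0 : 0 < rate_max.
Proof.
have /andP[_] := total_rate_bounds (0, 0)%N; exact/lt_le_trans/total_rate_gt0.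
Qed.

Local Notation p := (jump_prob rate).

Lemma tandem_jump_prob y z : z != y -> p y z = rate y z / total_rate y.
Proof.
by move=> /negPf zy; rewrite /jump_prob tandem_exit_rate gt_eqF ?total_rate_gt0// zy.
Qed.

Lemma tandem_step (f : nat * nat -> R) y : step p tandem_nb predT f y =
  (lambda y.2 * f (arrival y) + transfer_rate y * f (transfer y)
   + departure_rate y * f (departure y)) / total_rate y.
Proof.
rewrite -sum_rate /step big_distrl/= big_seq [RHS]big_seq.
apply: eq_bigr => z; rewrite mem_filter => /andP[zy _].
by rewrite tandem_jump_prob// mulrAC.
Qed.

Lemma tandem_kernel : locally_finite_kernel p tandem_nb.
Proof.
split.
- move=> y z; rewrite /jump_prob; case: ifP => _ //; case: ifP => // _.
  by rewrite divr_ge0 ?system_rate_ge0// tandem_exit_rate ltW// total_rate_gt0.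
- exact: tandem_nb_uniq.
- exact: tandem_nb_irreflexive.
- move=> y; have := tandem_step (fun=> 1) y; rewrite !mulr1 divff ?gt_eqF ?total_rate_gt0//.
  by move=> <-; apply: eq_bigr => z _; rewrite mulr1.
Qed.

Lemma tandem_step_generator (f : nat * nat -> R) y :
  step p tandem_nb predT f y = f y + generator f y / total_rate y.
Proof.
rewrite tandem_step /generator; have := total_rate_gt0 y.
rewrite /total_rate => t0; field; exact: lt0r_neq0.
Qed.

Lemma leads_to_jump y z x : z \in tandem_nb y -> 0 < rate y z ->
  leads_to p tandem_nb z x -> leads_to p tandem_nb y x.
Proof.
move=> zy rz; apply: (leads_to_step tandem_kernel _ _ _ zy).
rewrite tandem_jump_prob ?divr_gt0 ?total_rate_gt0//.
by move: zy; rewrite mem_filter => /andP[].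
Qed.

Lemma arrival_nb y : arrival y \in tandem_nb y.
Proof. by rewrite mem_filter arrival_neq inE eqxx. Qed.

Lemma transfer_nb y : transfer y \in tandem_nb y.
Proof. by rewrite mem_filter transfer_neq !inE eqxx orbT. Qed.

Lemma departure_nb y : (1 <= y.2)%N -> departure y \in tandem_nb y.
Proof. by move=> y2; rewrite mem_filter departure_neq y2 !inE eqxx !orbT. Qed.

(** Let a + b customers arrive while the second queue is empty, which is possible
  as lambda 0 > 0, then transfer b of them. *)
Lemma origin_leads_to a b : leads_to p tandem_nb (0, 0)%N (a, b).
Proof.
have up j : (j <= b)%N -> leads_to p tandem_nb ((a + j)%N, (b - j)%N) (a, b).
  elim: j => [|j IH] jb; first by rewrite addn0 subn0; exact: leads_to_refl.
  apply: leads_to_jump (transfer_nb _) _ _.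
    by rewrite system_rate_transfer /transfer_rate addnS.
  rewrite /transfer /= addnS /= subnSK//; exact/IH/ltnW.
have right i : (i <= a + b)%N -> leads_to p tandem_nb ((a + b - i)%N, 0%N) (a, b).
  elim: i => [|i IH] iab; first by have := up b (leqnn b); rewrite subnn subn0.
  apply: leads_to_jump (arrival_nb _) _ _; first by rewrite system_rate_arrival.
  by rewrite /arrival /= subnSK//; exact/IH/ltnW.
by have := right _ (leqnn _); rewrite subnn.
Qed.

(** Transfers and departures decrease 2 x1 + x2, so the origin is reached. *)
Lemma tandem_leads_to y x : leads_to p tandem_nb y x.
Proof.
case: x => a b; have [n] := ubnP (y.1.*2 + y.2)%N; elim: n y => // n IH [c e] /=.
case: c => [|c] yn; last first.
  apply: leads_to_jump (transfer_nb _) _ _; first by rewrite system_rate_transfer.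
  by apply: IH; rewrite /=; lia.
case: e yn => [|e] yn; first exact: origin_leads_to.
apply: leads_to_jump (departure_nb _ _) _ _ => //; first by rewrite system_rate_departure.
by apply: IH; rewrite /=; lia.
Qed.

Lemma tandem_survival_lt1 x y : exists m, survival p tandem_nb x m y < 1.
Proof.
have lt1 z : z \in tandem_nb y -> 0 < rate y z ->
    exists m, survival p tandem_nb x m y < 1.
  move=> zy rz; apply: (survival_lt1 tandem_kernel _ _ _ zy).
    rewrite tandem_jump_prob ?divr_gt0 ?total_rate_gt0//.
    by move: zy; rewrite mem_filter => /andP[].
  exact: tandem_leads_to.
case: y lt1 => -[|a] b lt1; last first.
  by apply: lt1 (transfer_nb _) _; rewrite system_rate_transfer.
case: b lt1 => [|b] lt1.
  by apply: lt1 (arrival_nb _) _; rewrite system_rate_arrival.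
by apply: lt1 (departure_nb _ _) _ => //; rewrite system_rate_departure.
Qed.

Lemma generator_potential_interior theta a b :
  generator (potential theta) (a.+1, b) = theta - mu1.
Proof.
rewrite /generator /potential /arrival /transfer /departure.
rewrite /transfer_rate /departure_rate /=.
rewrite heightS -!natr1; case: b => [|b] /=.
  have E := slope0 mu1_gt0 theta.
  transitivity (lambda 0 - mu1 + mu1 * slope theta 0); first by ring.
  by rewrite E; ring.
have E := slope_rec mu1_gt0 theta b.
rewrite (heightS theta b).
transitivity (lambda b.+1 - mu1 + mu1 * slope theta b.+1 - mu2 * slope theta b).
  by ring.
by rewrite E; ring.
Qed.

Lemma generator_potential_edge theta n : (K <= n)%N ->
  generator (potential theta) (0%N, n.+1) = - (mu2 * slope theta n).
Proof.
move=> Kn; rewrite /generator /potential /arrival /transfer /departure.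
rewrite /transfer_rate /departure_rate /=.
rewrite lambda_vanishes// heightS; lra.
Qed.

Lemma height_bounded_le N theta n : (n <= N)%N ->
  `|height theta n| <= \sum_(k < N.+1) `|height theta k|.
Proof.
move=> nN; rewrite (bigD1 (inord n))//= inordK// lerDl.
by apply: sumr_ge0.
Qed.

(** Foster's criterion for the potential, made nonnegative by a constant. The
  exceptional set is the part of the edge x1 = 0 where lambda may be nonzero or
  the slope below [delta]. *)
Lemma survival_summable theta N (delta : R) : theta < mu1 -> 0 < delta ->
  (forall n, (N <= n)%N -> delta <= slope theta n) ->
  forall x, exists C, forall n, \sum_(k < n) survival p tandem_nb x k x <= C.
Proof.
move=> th_lt delta0 slope_ge x.
pose C0 := \sum_(k < N.+1) `|height theta k|.
have height_ge n : - C0 <= height theta n.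
  have [nN|Nn] := leqP n N.
    by have := height_bounded_le _ theta _ nN; rewrite -/C0 ler_norml => /andP[].
  rewrite -(subnK (ltnW Nn)); elim: (n - N)%N => [|k IH].
    by have := height_bounded_le _ theta _ (leqnn N); rewrite -/C0 ler_norml => /andP[].
  rewrite addSn heightS; have := slope_ge (k + N)%N (leq_addl _ _); lra.
pose e := Num.min (mu1 - theta) (mu2 * delta).
have e0 : 0 < e by rewrite lt_min subr_gt0 th_lt mulr_gt0.
pose M := maxn N K.
pose F := [seq (0%N, n) | n <- iota 0 M.+1].
apply: (foster_criterion tandem_kernel x
  (fun y => potential theta y + C0) F (e / rate_max)).
- by rewrite divr_gt0 ?rate_max_gt0.
- by move=> y; rewrite /potential; have := height_ge y.2; have : 0 <= y.1%:R :> R by []; lra.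
- move=> y yF; rewrite stepD (step_cst tandem_kernel) tandem_step_generator.
  suff gen : generator (potential theta) y <= - e.
    have /andP[_ hi] := total_rate_bounds y; have t0 := total_rate_gt0 y.
    have : generator (potential theta) y / total_rate y <= - (e / rate_max).
      rewrite ler_pdivrMr// mulNr (le_trans gen)// lerN2 mulrAC ler_pdivrMr ?rate_max_gt0//.
      by rewrite ler_wpM2l// ltW.
    lra.
  have [em1 em2] : e <= mu1 - theta /\ e <= mu2 * delta by rewrite /e !ge_min !lexx orbT.
  case: y yF => -[|a] b yF; last by rewrite generator_potential_interior; lra.
  have Mb : (M < b)%N.
    rewrite ltnNge; apply/negP => bM; move/negP: yF; apply; apply/mapP; exists b => //.
    by rewrite mem_iota add0n ltnS.
  case: b Mb {yF} => // b Mb.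
  rewrite generator_potential_edge ?lerN2; last by move: Mb; rewrite /M; lia.
  apply: le_trans em2 _; rewrite ler_pM2l//; apply: slope_ge.
  by move: Mb; rewrite /M; lia.
- by move=> y _; exact: tandem_survival_lt1.
Qed.

(** From the origin the first queue can fill up to [i] by arrivals alone, without
  a return to the origin. *)
Lemma survival_from_empty i : exists2 c : R, 0 < c &
  forall n, c * survival p tandem_nb (0, 0)%N n (i, 0)%N <=
    survival p tandem_nb (0, 0)%N (n + i) (0, 0)%N.
Proof.
elim: i => [|i [c c0 IH]]; first by exists 1 => // m; rewrite mul1r addn0.
pose y : nat * nat := (i, 0)%N.
have py : 0 < p y (arrival y).
  by rewrite tandem_jump_prob ?arrival_neq// system_rate_arrival divr_gt0// total_rate_gt0.
exists (c * p y (arrival y)) => [|m]; first exact: mulr_gt0.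
rewrite addnS -addSn; apply: le_trans (IH m.+1).
rewrite -mulrA ler_pM2l// survivalS /step.
rewrite (perm_big _ (perm_to_rem (arrival_nb y))) big_cons/= lerDl.
apply: sumr_ge0 => z _.
by rewrite mulr_ge0 ?(kernel_ge0 tandem_kernel) ?(survival_ge0 tandem_kernel).
Qed.

(** The drift of the potential may be negative on the part x2 <= K of the edge
  x1 = 0. Truncating the potential below at a level C0 above its values there
  makes it a submartingale everywhere. *)
Lemma survival_not_summable (rho : R) : rho * mu2 = mu1 -> rho < 1 ->
  mu1 <= geometric_mean rho ->
  ~ exists C, forall n, \sum_(k < n) survival p tandem_nb (0, 0)%N k (0, 0)%N <= C.
Proof.
move=> rhoE rho1; set E := geometric_mean rho => mu1E.
have rho0 : 0 < rho by rewrite -(pmulr_lgt0 _ mu2_gt0) rhoE.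
have slope_neg n : (K <= n)%N -> slope E n <= 0.
  move=> Kn; rewrite (slope_stationary mu1_gt0 mu2_gt0 lambda_vanishes _ _ rhoE)// oppr_le0.
  have E0 : 0 < E by exact: lt_le_trans mu1E.
  by apply: divr_ge0; apply: mulr_ge0; rewrite ?subr_ge0; exact: ltW.
pose B := \sum_(k < K.+1) `|slope E k|.
have B0 : 0 <= B by exact: sumr_ge0.
have slopeB n : `|slope E n| <= B.
  wlog nK : n / (n <= K)%N => [H|].
    have [/H//|Kn] := leqP n K.
    rewrite (slope_stationary mu1_gt0 mu2_gt0 lambda_vanishes _ _ rhoE) ?(ltnW Kn)//.
    by rewrite -(slope_stationary mu1_gt0 mu2_gt0 lambda_vanishes _ K rhoE)// H.
  rewrite /B (bigD1 (inord n))//= inordK// lerDl; exact: sumr_ge0.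
pose C0 := \sum_(k < K.+1) `|height E k|.
have C00 : 0 <= C0 by exact: sumr_ge0.
pose phi y := Num.max (potential E y - C0) 0.
have phi_ge y : potential E y - C0 <= phi y by rewrite /phi le_max lexx.
have phi0 y : 0 <= phi y by rewrite /phi le_max lexx orbT.
pose i := (Num.truncn C0).+1.
have [c c0 reach] := survival_from_empty i.
apply: (submartingale_not_summable tandem_kernel _ phi (1 + B) (i, 0)%N i c) => //.
- by rewrite addr_ge0.
- rewrite /phi /potential /height big_ord0 /= !add0r; apply/max_idPr; lra.
- move=> y; have step0 : 0 <= step p tandem_nb predT phi y.
    exact: step_ge0 tandem_kernel _ _ _ _.
  have step_phi : potential E y - C0 + generator (potential E) y / total_rate y <=
      step p tandem_nb predT phi y.
    apply: le_trans (ler_step tandem_kernel predT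
      (fun z => potential E z + - C0) phi y (fun z _ _ => phi_ge z)).
    rewrite stepD (step_cst tandem_kernel) tandem_step_generator; lra.
  have [edge|gen0] : potential E y <= C0 \/ 0 <= generator (potential E) y.
    case: y {step0 step_phi} => -[|a] b; last first.
      by right; rewrite generator_potential_interior subr_ge0.
    have [bK|Kb] := leqP b K.
      left; rewrite /potential /= add0r; apply: le_trans (ler_norm _) _.
      exact: height_bounded_le.
    right; case: b Kb => // b Kb; rewrite generator_potential_edge// oppr_ge0.
    by rewrite pmulr_rle0// slope_neg.
  + by rewrite {1}/phi (max_idPr _)// subr_le0.
  + rewrite {1}/phi ge_max step0 andbT; apply: le_trans step_phi.
    by rewrite lerDl divr_ge0// ltW// total_rate_gt0.
- move=> y z; rewrite mem_filter => /andP[_] zy.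
  have pot : potential E z <= potential E y + (1 + B).
    move: zy; rewrite !inE /potential => /or3P[] /eqP-> /=.
    + rewrite -natr1; lra.
    + have : y.1.-1%:R <= y.1%:R :> R by rewrite ler_nat leq_pred.
      have := slopeB y.2; rewrite ler_norml heightS => /andP[]; lra.
    + case: y.2 => [|b] /=; first lra.
      have := slopeB b; rewrite ler_norml heightS => /andP[]; lra.
  rewrite {1}/phi ge_max; have := phi_ge y; have := phi0 y => h1 h2.
  by apply/andP; split; lra.
- rewrite /phi lt_max; apply/orP; left.
  by rewrite /potential /height big_ord0 addr0 /= subr_gt0 truncnS_gt.
Qed.

End TandemQueue.

Lemma expectation_geometric {R : realType} {d} {Omega : measurableType d}
    (P : probability Omega R) (Z : {RV P >-> nat}) (rho : R)
    (lambda : nat -> R) (K : nat) :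
  (forall n, 0 <= lambda n) -> (forall n, (K < n)%N -> lambda n = 0) ->
  geometric_law P Z rho ->
  ('E_P[fun w => lambda (Z w)] = (geometric_mean lambda K rho)%:E)%E.
Proof.
move=> lambda_ge0 lambda_vanishes geo; rewrite unlock.
have mZ k : measurable [set w | Z w = k].
  by rewrite -[X in measurable X]setTI; exact: (@measurable_funPT _ _ _ _ Z measurableT [set k]).
transitivity (\int[P]_w
    (\sum_(k < K.+1) (lambda k)%:E * (\1_[set w | Z w = k :> nat] w)%:E))%E.
  apply: eq_integral => w _ /=.
  have ind (k : nat) : \1_[set w | Z w = k :> nat] w = (Z w == k)%:R :> R.
    rewrite indicE; congr (_%:R); congr nat_of_bool.
    by apply/idP/idP => [|/eqP ?]; [rewrite inE /= => ->|rewrite inE].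
  under eq_bigr do rewrite ind -EFinM; rewrite sumEFin; congr EFin.
  have [ZK|KZ] := leqP (Z w) K.
    rewrite (bigD1 (inord (Z w)))//= inordK// eqxx mulr1 big1 ?addr0// => k kZ.
    case: eqP => [Zk|]; last by rewrite mulr0.
    by move: kZ; rewrite -val_eqE /= inordK// Zk eqxx.
  rewrite lambda_vanishes// big1// => k _; case: eqP => [Zk|]; last by rewrite mulr0.
  by move: KZ; rewrite Zk ltnNge -ltnS ltn_ord.
rewrite ge0_integral_sum//; last 2 first.
- move=> k; apply: measurable_funeM; apply/measurable_EFinP.
  exact: measurable_indic.
- by move=> k w _; rewrite -EFinM lee_fin mulr_ge0.
rewrite /geometric_mean big_distrr/= -sumEFin; apply: eq_bigr => k _.
rewrite ge0_integralZl//; last 2 first.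
- by apply/measurable_EFinP; exact: measurable_indic.
- by rewrite lee_fin.
rewrite integral_indic// setIT [X in (_ * X)%E](geo k) -EFinM; congr EFin; ring.
Qed.

Theorem theorem5 (R : realType) (lambda : nat -> R) (mu1 mu2 : R)
    (lambda_ge0 : forall n, 0 <= lambda n) (lambda0_gt0 : 0 < lambda 0%N)
    (mu1_gt0 : 0 < mu1) (mu2_gt0 : 0 < mu2)
    (lambda_eventually0 : exists K : nat, forall n : nat, (K < n)%N -> lambda n = 0)
    (d : measure_display) (Omega : measurableType d)
    (P : nat * nat -> probability Omega R)
    (X : R -> Omega -> option (nat * nat))
    (X_process : forall x : nat * nat,
       minimal_process (system_rate lambda mu1 mu2) (P x) x X) :
  (mu1 < mu2 ->
     forall (d' : measure_display) (Omega' : measurableType d')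
       (P' : probability Omega' R) (Z : {RV P' >-> nat}),
       geometric_law P' Z (mu1 / mu2) ->
       (ergodic P X <-> ('E_P' [fun w => lambda (Z w)] < mu1%:E)%E)) /\
  (mu2 <= mu1 -> ergodic P X).
Proof.
have [K lambda_vanishes] := lambda_eventually0.
have pK := tandem_kernel lambda_ge0 lambda0_gt0 mu1_gt0 mu2_gt0 lambda_vanishes.
have exit_bounds y : rate_min lambda mu1 mu2 <=
    exit_rate (system_rate lambda mu1 mu2) y <= rate_max lambda mu1 mu2 K.
  by rewrite tandem_exit_rate//; exact: total_rate_bounds.
have min0 : 0 < rate_min lambda mu1 mu2 by exact: rate_min_gt0.
(* Both stable regimes provide some theta below mu1 with an eventually positive
   slope. *)
have stable_of theta : theta < mu1 -> (exists N delta, 0 < delta /\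
    forall n, (N <= n)%N -> delta <= slope lambda mu1 mu2 theta n) -> ergodic P X.
  move=> theta_lt [N [delta [delta0 slope_ge]]]; split => [x y|x].
    apply: (accessible_of_leads_to pK min0 exit_bounds (X_process x)).
    exact: tandem_leads_to lambda_ge0 lambda0_gt0 mu1_gt0 mu2_gt0 lambda_vanishes x y.
  apply: (integrable_of_summable_survival pK min0 exit_bounds (X_process x)).
  exact: (survival_summable lambda_ge0 lambda0_gt0 mu1_gt0 mu2_gt0
    lambda_vanishes theta N delta).
split => [mu12 d' Omega' P' Z geo|mu21]; last first.
  apply: (stable_of (mu1 / 2)); first lra.
  by apply: (slope_eventually_gt0_transient mu1_gt0 mu2_gt0 lambda_vanishes);
    rewrite ?divr_gt0.
have rhoE : mu1 / mu2 * mu2 = mu1 by rewrite divfK// gt_eqF.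
have rho1 : mu1 / mu2 < 1 by rewrite ltr_pdivrMr// mul1r.
rewrite (expectation_geometric P' Z (mu1 / mu2) lambda K)// lte_fin.
set E := geometric_mean _ _ _; split => [[_ recurrent]|E_lt].
  rewrite ltNge; apply/negP => mu1E.
  apply: (survival_not_summable lambda_ge0 lambda0_gt0 mu1_gt0
    mu2_gt0 lambda_vanishes _ rhoE rho1 mu1E).
  exact: (summable_survival_of_integrable pK exit_bounds
    (X_process (0, 0)%N) (recurrent (0, 0)%N)).
apply: (stable_of ((E + mu1) / 2)); first lra.
apply: (slope_eventually_gt0_subcritical lambda_ge0 mu1_gt0 mu2_gt0
  lambda_vanishes _ _ rhoE rho1); rewrite -/E; lra.
Qed.
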